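(* For $\epsilon\in(0,1)$, any depth four $\Sigma\Pi^{[O(\sqrt n)]}\Sigma\Pi^{[\sqrt n]}$ circuit computing the polynomial $\mathrm{NW}_{n,\epsilon}(X)$ (over any field) must be of size $2^{\Omega_\epsilon(\sqrt n\log n)}$.
   Context: An arithmetic circuit over a field $\mathbb{F}$ is a directed acyclic graph whose internal nodes are labelled by addition or multiplication gates and whose leaves are labelled by variables or field elements; it computes a polynomial at its output gate. Its size is its number of nodes. A $\Sigma\Pi^{[D]}\Sigma\Pi^{[t]}$ circuit is a depth four circuit with alternating layers of addition and multiplication gates and an addition gate at the top, in which the fan-in of the multiplication gates in the layer adjacent to the output gate is at most $D$ and the fan-in of the multiplication gates in the bottom layer is at most $t$. Such circuits compute polynomials of the form $\sum_{i=1}^{s}\prod_{j=1}^{d_i}Q_{i,j}$ with $\deg Q_{i,j}\le t$ for all $i,j$ and $d_i\le D$ for all $i$. A $\Sigma\Pi^{[O(\sqrt n)]}\Sigma\Pi^{[\sqrt n]}$ circuit is one with $D=O(\sqrt n)$ and $t=\sqrt n$. The notation $\Omega_\epsilon$ indicates that the implicit constant depends on $\epsilon$. For integers $n>0$ ranging over prime powers and $0<\epsilon<1$, $\mathrm{NW}_{n,\epsilon}(X)$ is the polynomial over $\mathbb{F}$ in the $n^2$ variables $x_{ij}$, $i,j\in\{1,\dots,n\}$, defined by $$\mathrm{NW}_{n,\epsilon}(X)=\sum_{a(z)\in\mathbb{F}_n[z]}x_{1a(1)}x_{2a(2)}\cdots x_{na(n)},$$ where $a(z)$ runs over all univariate polynomials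 in $\mathbb{F}_n[z]$ of degree $<\epsilon n$, and the field $\mathbb{F}_n$ with $n$ elements is identified with $\{1,2,\dots,n\}$. *)

(* Defs.v *)
From HB Require Import structures.
From mathcomp Require Import all_boot all_order all_algebra.
From mathcomp Require Import mpoly.

Set Implicit Arguments.
Unset Strict Implicit.
Unset Printing Implicit Defensive.

Import Order.TTheory GRing.Theory Num.Theory.
Local Open Scope ring_scope.

(* The children of a gate form a sequence: parallel edges are allowed, and the
   fan-in counts them with multiplicity. *)
Inductive gate (F : Type) (m : nat) (N : Type) : Type :=
| Var of 'I_m
| Const of F
| Add of seq N
| Mul of seq N.

Arguments Var {F m N}.
Arguments Const {F m N}.
Arguments Add {F m N}.
Arguments Mul {F m N}.

Definition children (F : Type) (m : nat) (N : Type) (g : gate F m N) : seq N :=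
  match g with Add us | Mul us => us | _ => [::] end.

Definition is_leaf (F : Type) (m : nat) (N : Type) (g : gate F m N) : bool :=
  match g with Var _ | Const _ => true | _ => false end.

Definition is_add (F : Type) (m : nat) (N : Type) (g : gate F m N) : bool :=
  if g is Add _ then true else false.

Record circuit (F : Type) (m : nat) : Type := Circuit {
  node : finType;
  label : node -> gate F m node;
  output : node;
  acyclic : forall u v : node, v \in children (label u) ->
    ~~ connect (fun a b : node => b \in children (label a)) v u
}.

Definition circuit_size (F : Type) (m : nat) (C : circuit F m) : nat :=
  #|node C|.

Definition gate_value (F : fieldType) (m : nat) (N : Type)
    (val : N -> {mpoly F[m]}) (g : gate F m N) : {mpoly F[m]} :=
  match g with
  | Var i => 'X_i
  | Const c => c%:MP
  | Add us => \sum_(u <- us) val u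
  | Mul us => \prod_(u <- us) val u
  end.

(* Since the circuit is acyclic, exactly one assignment [val] of polynomials to
   its nodes satisfies all the gate equations. *)
Definition computes (F : fieldType) (m : nat) (C : circuit F m)
    (p : {mpoly F[m]}) : Prop :=
  exists2 val : node C -> {mpoly F[m]},
    forall u, val u = gate_value val (label u) & val (output C) = p.

(* Gates of layers 0, 1, 2, 3 (from the output down) are +, *, +, *.  The layer
   assigned to a leaf is irrelevant: a leaf may feed a gate of any layer. *)
Definition SigmaPiSigmaPi (D t : nat) (F : Type) (m : nat) (C : circuit F m)
    : Prop :=
  exists layer : node C -> nat,
  [/\ is_add (label (output C)) /\ layer (output C) = 0%N,
      forall u, match label u with
                | Var _ | Const _ => True
                | Add us => layer u = 0%N \/ layer u = 2%N
                | Mul us => (layer u = 1%N /\ (size us <= D)%N)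
                         \/ (layer u = 3%N /\ (size us <= t)%N)
                end
    & forall u v, v \in children (label u) ->
        is_leaf (label v) \/ layer v = (layer u).+1].

(* [K] is the field with [n] elements, identified with the index set by [idx];
   x_ij is the variable of index [mxvec_index i j] among n * n.  As eps < 1, the
   polynomials of degree < eps * n are among those of size at most n.  The zero
   polynomial is included. *)
Definition NW (R : numDomainType) (eps : R) (F : fieldType) (n : nat)
    (K : finFieldType) (idx : K -> 'I_n) : {mpoly F[n * n]} :=
  \sum_(a : {poly_n K} | (size a).-1%:R < eps * n%:R)
    \prod_(z : K) 'X_(mxvec_index (idx z) (idx (val a).[z])).

(* Main.v *)
(** The measure of a polynomial is the dimension of the span of its shifted
    partial derivatives.  For a depth four circuit, a derivative of order [r] of
    a product [Q_1 ... Q_D] shifted by a monomial of degree [l] is a combination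
    of subproducts of the [Q_j] with coefficients of degree about [l + r t], so
    the measure is at most [s 2^D] times the number of monomials of that degree.

    For the Nisan-Wigderson polynomial, set [x_zy] to [y = 0] on [k - r] rows,
    where [k] is the number of coefficients: only the polynomials vanishing on
    these rows survive, and deriving along [r] more rows isolates each of [n^r]
    single monomials.  Any two of them agree in fewer than [r] of the remaining
    [n - k] rows, so their shifts overlap little and inclusion-exclusion shows
    that they span a space of the largest possible order.  With [N] variables
    and [h = n - k - r], the shift [l] is the largest one for which
    [(1 + N/l)^h >= 2 n^r].  Its maximality bounds the gain
    [(1 + N/(l+1))^(r t + 1)] of the circuit by [(2 n^r)^(1/2)] as soon as
    [2 (r t + 1) <= h], whence [n^r <= 8 (s 2^D)^2]; then take [r] of order
    [sqrt n]. *)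

Require Import Defs.
From mathcomp Require Import all_boot all_order all_algebra.
From mathcomp Require Import mpoly.
From mathcomp Require Import reals sequences exp.
From mathcomp Require Import zify lra.

Set Implicit Arguments.
Unset Strict Implicit.
Unset Printing Implicit Defensive.

Import Order.TTheory GRing.Theory Num.Theory.

(** * Counting shifted monomials *)

Local Open Scope nat_scope.

(** No exponent exceeds [d], so these monomials are the [N]-tuples over ['I_d.+1] of sum at most
    [d]. *)
Lemma card_bmultinom N d : #|{: 'X_{1..N < d.+1}}| = 'C(N + d, N).
Proof.
rewrite -card_partial_ord_partitions.
pose f (m : 'X_{1..N < d.+1}) : N.-tuple 'I_d.+1 :=
  [tuple inord (val m i) | i < N].
have le_m (m : 'X_{1..N < d.+1}) i : val m i < d.+1.
  by apply: leq_ltn_trans (bmdeg m); rewrite mdegE (bigD1 i) //= leq_addr.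
have f_inj : injective f.
  move=> m1 m2 /(congr1 (fun t : N.-tuple _ => fun i => val (tnth t i))) E.
  apply/val_inj/mnmP => i; move/(congr1 (fun g => g i)): E.
  by rewrite /= !tnth_mktuple !inordK.
rewrite -(card_codom f_inj); apply: eq_card => t; rewrite !inE.
apply/codomP/idP => [[m ->]|le_t].
  rewrite big_tuple -ltnS; apply: leq_ltn_trans (bmdeg m).
  rewrite mdegE; apply: leq_sum => i _.
  by rewrite tnth_mktuple inordK.
have lt_m : mdeg [multinom val (tnth t i) | i < N] < d.+1.
  rewrite mdegE ltnS; move: le_t; rewrite big_tuple.
  by apply: leq_trans; apply: leq_sum => i _; rewrite mnmE.
exists (BMultinom lt_m); apply: eq_from_tnth => i.
by rewrite tnth_mktuple /= mnmE inord_val.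
Qed.

Lemma mul_binS N d : d.+1 * 'C(N + d.+1, N) = (N + d).+1 * 'C(N + d, N).
Proof. by have := mul_bin_down (N + d).+1 N; rewrite addnS /=; nia. Qed.

(** Passing from degree i to i+1 multiplies the binomial by (N+i+1)/(i+1), which for i >= l is at
    most (N+l+1)/(l+1). *)
Lemma bin_shift_up N l e :
  'C(N + (l + e), N) * l.+1 ^ e <= (N + l).+1 ^ e * 'C(N + l, N).
Proof.
elim: e => [|e IH]; first by rewrite addn0 !expn0 muln1 mul1n.
rewrite addnS !expnS -(leq_pmul2l (ltn0Sn (l + e))) mulnA mul_binS.
have: ((N + (l + e)).+1 * l.+1) * ('C(N + (l + e), N) * l.+1 ^ e) <=
      ((l + e).+1 * (N + l).+1) * ((N + l).+1 ^ e * 'C(N + l, N)).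
  by apply: leq_mul => //; nia.
by move: (_ ^ e) (_ ^ e) 'C(_, _) 'C(_, _) => a b c d; nia.
Qed.

(** Passing from degree i to i-1 multiplies the binomial by i/(N+i), which for i <= l is at most
    l/(N+l). *)
Lemma bin_shift_down N l e : e <= l ->
  'C(N + (l - e), N) * (N + l) ^ e <= l ^ e * 'C(N + l, N).
Proof.
elim: e => [|e IH] lt_el; first by rewrite subn0 !expn0 muln1 mul1n.
have {IH} IH := IH (ltnW lt_el).
have := mul_binS N (l - e.+1); rewrite subnSK // => E.
have [d lE] : {d | l = d + e.+1} by exists (l - e.+1); rewrite subnK.
subst l; move: E IH; rewrite addnK (_ : d + e.+1 - e = d.+1); last lia.
move=> E IH; rewrite !expnS.
rewrite -(leq_pmul2l (ltn0Sn (N + d))) mulnA -E.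
have: ((N + (d + e.+1)) * d.+1) * ('C(N + d.+1, N) * (N + (d + e.+1)) ^ e) <=
   ((N + d).+1 * (d + e.+1)) * ((d + e.+1) ^ e * 'C(N + (d + e.+1), N)).
  by apply: leq_mul => //; nia.
rewrite -!mulnA; move: (_ ^ e) (_ ^ e) 'C(_, _) 'C(_, _) => a b c1 c2; nia.
Qed.

(** Inclusion-exclusion cut off after pairs: a set added to the family meets the union of the sets
    already there in at most [size s * w] elements. *)
Lemma card_bigcup_ge (T B : finType) (A : B -> {set T}) M w (s : seq B) :
  uniq s -> (forall b, #|A b| = M) ->
  (forall b b', b != b' -> #|A b :&: A b'| <= w) ->
  size s * M <= #|\bigcup_(b <- s) A b| + size s * size s * w.
Proof.
move=> + AM Aw; elim: s => [|b s IH] //= /andP[b_s us].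
have {}IH := IH us.
have cap : #|A b :&: \bigcup_(c <- s) A c| <= size s * w.
  elim: s b_s {IH us} => [|c s IH]; first by rewrite big_nil setI0 cards0.
  rewrite inE negb_or => /andP[bc bs]; rewrite big_cons setIUr mulSn.
  apply: leq_trans (leq_add (Aw _ _ bc) (IH bs)).
  by rewrite -cardsUI leq_addr.
have := cardsUI (A b) (\bigcup_(c <- s) A c); rewrite big_cons AM; nia.
Qed.

(* Bernoulli's inequality (1 - N/(L+N))^j >= 1 - jN/L, cleared of denominators. *)
Lemma bernoulli_expn N L j : j * N <= L ->
  (N + L) ^ j * (L - j * N) <= L ^ j.+1.
Proof.
elim: j => [|j IH] le; first by rewrite expn0 mul1n subn0.
have {}IH := IH (leq_trans (leq_mul (leqnSn j) (leqnn N)) le).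
rewrite expnSr (expnS L j.+1).
have : (N + L) * (L - j.+1 * N) <= L * (L - j * N) by nia.
move: IH; move: (_ ^ _) (_ ^ j) (L - _) (L - _) => a b c d; nia.
Qed.

Lemma ex_shift_degree n r h N : 0 < n -> r < h -> h <= n -> n * n <= N ->
  exists l, [/\ h <= l, 2 * n ^ r * l ^ h <= (N + l) ^ h &
               (N + l).+1 ^ h < 2 * n ^ r * l.+1 ^ h].
Proof.
move=> n0 rh hn nN.
pose P l := (h <= l) && (2 * n ^ r * l ^ h <= (N + l) ^ h).
(* The search starts at [l = h]: there 1 + N/h >= n + 1, and (n+1)^h >= (n+1)^(r+1) >= 2 n^r. *)
have Ph : P h.
  rewrite /P leqnn /=; apply: (@leq_trans ((n.+1 * h) ^ h)); last first.
    rewrite leq_exp2r ?(leq_ltn_trans _ rh) // mulSn addnC leq_add2r.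
    exact: leq_trans (leq_mul (leqnn n) hn) nN.
  rewrite expnMn leq_mul2r; apply/orP; right.
  apply: (@leq_trans (n.+1 ^ r.+1)); last by rewrite leq_exp2l.
  by rewrite expnS leq_mul //; case: (r) => // r'; rewrite leq_exp2r.
(* Beyond 2hN, Bernoulli's inequality gives (1 + N/l)^h < 2, so the search is bounded. *)
have bound : forall l, P l -> l <= 2 * (h * N).
  move=> l /andP[hl]; rewrite leqNgt => le; apply/negP => lt.
  have := @bernoulli_expn N l h; have -> : h * N <= l by lia.
  move=> /(_ isT); rewrite expnS.
  have nr : 0 < n ^ r by rewrite expn_gt0 n0.
  have lh : 0 < l ^ h by rewrite expn_gt0; apply/orP; left; lia.
  have : l < 2 * (l - h * N) by lia.
  move: le lh nr; move: (l - _) (_ ^ h) (_ ^ h) (_ ^ r) => a b c d; nia.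
case: (ex_maxnP (ex_intro P h Ph) bound) => l /andP[hl Pl] lmax.
exists l; split=> //; rewrite ltnNge; apply/negP => le.
have := lmax l.+1; rewrite /P addnS le (leqW hl) => /(_ isT).
by rewrite ltnn.
Qed.

(** The lower bound on (N+l)^h makes the overlap term at most half of the count, so n^r <= 2 s g
    with g = ((N+l+1)/(l+1))^e. The upper bound at l+1 gives g^2 <= 2 n^r. Squaring the first
    estimate and inserting the second ends the proof. *)
Lemma shifted_count_arith n r h e N l s : 0 < n -> 2 * e <= h -> h <= l ->
  2 * n ^ r * l ^ h <= (N + l) ^ h ->
  (N + l).+1 ^ h < 2 * n ^ r * l.+1 ^ h ->
  n ^ r * 'C(N + l, N) <=
    s * 'C(N + (l + e), N) + n ^ r * n ^ r * 'C(N + (l - h), N) ->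
  n ^ r <= 8 * s ^ 2.
Proof.
move=> n0 eh hl lower upper count.
have nr : 0 < n ^ r by rewrite expn_gt0 n0.
have small : 2 * n ^ r * 'C(N + (l - h), N) <= 'C(N + l, N).
  have Nl : 0 < (N + l) ^ h.
    by rewrite expn_gt0; case: (h) hl => [|h'] hl; apply/orP; [right|left; lia].
  rewrite -(leq_pmul2r Nl) -mulnA.
  have := bin_shift_down N hl; move: lower.
  move: (_ ^ h) (_ ^ h) (_ ^ r) 'C(_, _) 'C(_, _) => a b c d f; nia.
have {small count} count : n ^ r * 'C(N + l, N) <= 2 * s * 'C(N + (l + e), N).
  move: small count nr; move: (_ ^ r) 'C(_, _) 'C(_, _) 'C(_, _); nia.
have C0 : 0 < 'C(N + l, N) by rewrite bin_gt0 leq_addr.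
have {count} count : n ^ r * l.+1 ^ e <= 2 * s * (N + l).+1 ^ e.
  rewrite -(leq_pmul2r C0); have := bin_shift_up N l e; move: count.
  move: (_ ^ r) (_ ^ e) (_ ^ e) 'C(_, _) 'C(_, _); nia.
have {upper} upper : (N + l).+1 ^ (2 * e) <= 2 * n ^ r * l.+1 ^ (2 * e).
  have l0 : 0 < l.+1 ^ (h - 2 * e) by rewrite expn_gt0.
  rewrite -(leq_pmul2r l0) -mulnA -expnD subnKC //.
  apply: leq_trans (ltnW upper); rewrite -{2}(subnKC eh) expnD leq_mul2l.
  apply/orP; right; case: (h - 2 * e) => // j; rewrite leq_exp2r //.
  by rewrite ltnS leq_addl.
have l0 : 0 < l.+1 ^ e * l.+1 ^ e by rewrite muln_gt0 expn_gt0.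
rewrite mul2n -addnn !expnD in upper.
rewrite -(leq_pmul2r nr) -(leq_pmul2r l0).
have le : 4 * s * s * ((N + l).+1 ^ e * (N + l).+1 ^ e) <=
          4 * s * s * (2 * n ^ r * (l.+1 ^ e * l.+1 ^ e)).
  by rewrite leq_mul2l upper orbT.
have := leq_mul count count; move: le.
move: (n ^ r) (l.+1 ^ e) ((N + l).+1 ^ e) => B y x; lia.
Qed.

(** * Shifted partial derivatives of depth four circuits *)

Local Open Scope ring_scope.

(** Distinct monomials are independent: the matrix of the [c] times the coefficient matrix of the
    [p] is an identity matrix of rank [size S], and it factors through dimension [#|J|]. *)
Lemma monomials_le_span (F : fieldType) n (S : seq 'X_{1..n}) (J : finType)
    (p : J -> {mpoly F[n]}) : uniq S ->
  (forall m, m \in S -> exists c : J -> F, 'X_[m] = \sum_j c j *: p j) ->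
  (size S <= #|J|)%N.
Proof.
move=> uS spanS.
have /fin_all_exists[c cE] : forall i : 'I_(size S),
    exists c : J -> F, 'X_[tnth (in_tuple S) i] = \sum_j c j *: p j.
  by move=> i; apply: spanS; apply: mem_tnth.
pose A := \matrix_(i < size S, j < #|J|) c i (enum_val j).
pose B := \matrix_(j < #|J|, i < size S)
  (p (enum_val j))@_(tnth (in_tuple S) i).
have AB : A *m B = 1%:M.
  apply/matrixP => i k; rewrite !mxE.
  transitivity (('X_[tnth (in_tuple S) i] : {mpoly F[n]})@_(tnth (in_tuple S) k)).
    rewrite cE raddf_sum (reindex (@enum_val J predT)) /=;
      last exact/onW_bij/enum_val_bij.
    by apply: eq_bigr => j _; rewrite !mxE mcoeffZ.
  rewrite mcoeffX; congr (_%:R); rewrite !(tnth_nth 0%MM) /=.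
  by rewrite nth_uniq.
by have := mulmx_max_rank A B; rewrite AB mxrank1.
Qed.

(** [msize] is the total degree plus one, and 0 at the zero polynomial; hence [msize p <= d.+1]
    means degree at most [d]. *)
Lemma msizeM_pred (R : idomainType) n (p q : {mpoly R[n]}) :
  (msize (p * q) <= (msize p + msize q).-1)%N.
Proof.
have [->|p0] := eqVneq p 0; first by rewrite mul0r msize0.
have [->|q0] := eqVneq q 0; first by rewrite mulr0 msize0.
by rewrite msizeM.
Qed.

Lemma msize_mderiv (R : nzRingType) n (i : 'I_n) (p : {mpoly R[n]}) :
  (msize p^`M(i) <= msize p)%N.
Proof.
rewrite [X in (X <= _)%N]msizeE; apply/bigmax_leqP_seq => m + _.
rewrite mcoeff_msupp mcoeff_mderiv => nz.
have /msize_mdeg_lt : (m + U_(i))%MM \in msupp p.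
  by rewrite mcoeff_msupp; apply: contraNneq nz => ->; rewrite mul0rn.
by apply: leq_ltn_trans; rewrite mdegD leq_addr.
Qed.

Lemma mderiv_prod (R : comNzRingType) n (I : finType) (i : 'I_n)
    (p : I -> {mpoly R[n]}) (A : {set I}) :
  (\prod_(j in A) p j)^`M(i) =
  \sum_(j in A) (p j)^`M(i) * \prod_(k in A :\ j) p k.
Proof.
elim: {A}#|A| {-2}A (erefl #|A|) => [|c IH] A.
  move/eqP; rewrite cards_eq0 => /eqP->; rewrite !big_set0.
  by rewrite -mpolyC1 mderivC.
move=> cA; have /card_gt0P[j0 j0A] : (0 < #|A|)%N by rewrite cA.
rewrite (big_setD1 j0) //= mderivM [in RHS](big_setD1 j0) //=; congr (_ + _).
rewrite IH; last by move: cA; rewrite (cardsD1 j0) j0A => -[].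
rewrite mulr_sumr; apply: eq_bigr => j; rewrite !inE => /andP[jj0 jA].
rewrite mulrCA; congr (_ * _).
rewrite [in RHS](big_setD1 j0) ?inE 1?eq_sym ?jj0 //=.
by congr (_ * _); apply: eq_bigl => k; rewrite !inE andbCA.
Qed.

(* Contains the shifted partial derivatives of [\sum_i \prod_j Q i j]. *)
Definition subproduct_span (F : fieldType) n (I J : finType)
    (Q : I -> J -> {mpoly F[n]}) (d : nat) (p : {mpoly F[n]}) : Prop :=
  exists2 c : I * {set J} -> {mpoly F[n]}, (forall x, msize (c x) <= d.+1)%N &
    p = \sum_x c x * \prod_(j in x.2) Q x.1 j.

Section SubproductSpan.
Context (F : fieldType) (n : nat) (I J : finType) (Q : I -> J -> {mpoly F[n]}).
Implicit Types (p q : {mpoly F[n]}) (d : nat).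

Lemma subproduct_span0 d : subproduct_span Q d 0.
Proof.
exists (fun=> 0); first by move=> x; rewrite msize0.
by rewrite big1 // => x _; rewrite mul0r.
Qed.

Lemma subproduct_span_leq d d' p : (d <= d')%N ->
  subproduct_span Q d p -> subproduct_span Q d' p.
Proof. by move=> dd' [c cd ->]; exists c => // z; apply: leq_trans (cd z) _. Qed.

Lemma subproduct_spanD d p q : subproduct_span Q d p ->
  subproduct_span Q d q -> subproduct_span Q d (p + q).
Proof.
move=> [c cd ->] [c' cd' ->]; exists (fun x => c x + c' x).
  by move=> x; apply: leq_trans (msizeD_le _ _) _; rewrite geq_max cd cd'.
by rewrite -big_split; apply: eq_bigr => x _; rewrite mulrDl.
Qed.

Lemma subproduct_span_sum (T : Type) (s : seq T) (P : pred T) G d :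
  (forall x, P x -> subproduct_span Q d (G x)) ->
  subproduct_span Q d (\sum_(x <- s | P x) G x).
Proof.
move=> H; apply: (big_ind (subproduct_span Q d)) => //.
  exact: subproduct_span0.
exact: subproduct_spanD.
Qed.

Lemma subproduct_span_gen d i (A : {set J}) p : (msize p <= d.+1)%N ->
  subproduct_span Q d (p * \prod_(j in A) Q i j).
Proof.
move=> pd; exists (fun x => if x == (i, A) then p else 0).
  by move=> x; case: ifP => //; rewrite msize0.
rewrite [RHS](bigD1 (i, A)) //= eqxx [X in _ + X]big1 ?addr0 // => x /negPf->.
by rewrite mul0r.
Qed.

Lemma subproduct_spanX d m p : subproduct_span Q d p ->
  subproduct_span Q (mdeg m + d) ('X_[m] * p).
Proof.
move=> [c cd ->]; rewrite mulr_sumr; apply: subproduct_span_sum => -[i A] _.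
rewrite mulrA; apply: subproduct_span_gen.
apply: leq_trans (msizeM_pred _ _) _.
by rewrite msizeX addSn /= -addnS leq_add2l cd.
Qed.

(** By the product rule, either the coefficient is derived, or one factor [Q i j] is derived and
    absorbed into the coefficient, which leaves a smaller subproduct at the cost of degree [t]. *)
Lemma subproduct_span_mderiv d t k p : (forall i j, msize (Q i j) <= t.+1)%N ->
  subproduct_span Q d p -> subproduct_span Q (d + t) p^`M(k).
Proof.
move=> Qt [c cd ->]; rewrite raddf_sum /=.
apply: subproduct_span_sum => -[i A] _ /=.
rewrite mderivM; apply: subproduct_spanD.
  apply: subproduct_span_gen; apply: leq_trans (msize_mderiv _ _) _.
  by apply: leq_trans (cd _) _; rewrite ltnS leq_addr.
rewrite mderiv_prod mulr_sumr; apply: subproduct_span_sum => j _.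
rewrite mulrA; apply: subproduct_span_gen.
apply: leq_trans (msizeM_pred _ _) _.
have := leq_add (cd (i, A)) (leq_trans (msize_mderiv k (Q i j)) (Qt i j)).
by rewrite addSn addnS; case: (_ + _)%N.
Qed.

Lemma subproduct_span_mderivs d t p (T : finType) (u : T -> 'I_n) (A : {set T}) :
  (forall i j, msize (Q i j) <= t.+1)%N -> subproduct_span Q d p ->
  subproduct_span Q (d + #|A| * t) p^`M[\sum_(z in A) U_(u z)].
Proof.
move=> Qt pd; rewrite mderiv_summ.
have -> : #|A| = size [seq U_(u x)%MM | x <- index_enum T & x \in A].
  by rewrite size_map cardE.
elim: [seq x <- _ | _] => [|x s IH] /=; first by rewrite addn0.
rewrite mulSn addnCA addnC mderivmU1m.
exact: subproduct_span_mderiv.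
Qed.

(** Splitting coefficients into monomials puts everything in the span of the products of a monomial
    of degree at most [d] with a subproduct; the bound counts these products. *)
Lemma subproduct_span_card d (S : seq 'X_{1..n}) : uniq S ->
  (forall m, m \in S -> subproduct_span Q d 'X_[m]) ->
  (size S <= #|I| * 2 ^ #|J| * 'C(n + d, n))%N.
Proof.
move=> uS spanS.
suff : (size S <= #|{: (I * {set J}) * 'X_{1..n < d.+1}}|)%N.
  rewrite !card_prod card_bmultinom; have := card_powerset [set: J].
  by rewrite powersetT !cardsT => ->.
apply: (monomials_le_span (p := fun x : (I * {set J}) * 'X_{1..n < d.+1} =>
  'X_[val x.2] * \prod_(j in x.1.2) Q x.1.1 j)) => // m /spanS[c cd ->].
exists (fun x => (c x.1)@_(val x.2)).
rewrite (eq_bigr (fun x => \sum_(m' : 'X_{1..n < d.+1})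
   (c x)@_(val m') *: ('X_[val m'] * \prod_(j in x.2) Q x.1 j))).
  by rewrite pair_bigA.
move=> x _; rewrite {1}(mpolywE (cd x)) mulr_suml.
by apply: eq_bigr => m' _; rewrite scalerAl.
Qed.

End SubproductSpan.

(** * Depth four circuits as sums of products of low-degree polynomials *)

Lemma msize_prod_seq (R : idomainType) n (T : eqType) (s : seq T) (d : nat)
    (p : T -> {mpoly R[n]}) : (forall x, x \in s -> (msize (p x) <= d.+1)%N) ->
  (msize (\prod_(x <- s) p x) <= (size s * d).+1)%N.
Proof.
elim: s => [|x s IH] sd; first by rewrite big_nil msize1.
rewrite big_cons; apply: leq_trans (msizeM_pred _ _) _.
have {}IH := IH (fun y ys => sd y (@mem_behead _ (x :: s) y ys)).
have := leq_add (sd x (mem_head _ _)) IH; rewrite mulSn.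
by rewrite addSn addnS; case: (_ + msize _)%N.
Qed.

Lemma msize_sum_seq (R : nzRingType) n (T : eqType) (s : seq T) (d : nat)
    (p : T -> {mpoly R[n]}) : (forall x, x \in s -> (msize (p x) <= d)%N) ->
  (msize (\sum_(x <- s) p x) <= d)%N.
Proof.
move=> sd; apply: leq_trans (msize_sum _ _ _) _.
by apply/bigmax_leqP_seq => x xs _; apply: sd.
Qed.

(** The substitution [lq] has degree at most 1, so the degree bounds of the layers survive it. The
    bound [t'] is positive because a variable may feed an upper gate directly, even for [t = 0];
    coefficients of degree 1 are allowed because a leaf may feed the output gate. *)
Lemma circuit_subproduct_span (F : fieldType) m k D t t' (C : circuit F m)
    (p : {mpoly F[m]}) (lq : m.-tuple {mpoly F[k]}) :
  SigmaPiSigmaPi D t C -> computes C p -> (0 < t')%N -> (t <= t')%N ->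
  (forall i, msize (tnth lq i) <= 2)%N ->
  exists2 Q : node C -> 'I_D -> {mpoly F[k]},
    forall u j, (msize (Q u j) <= t'.+1)%N & subproduct_span Q 1 (p \mPo lq).
Proof.
move=> [layer [[addo lay0] lab ch]] [val valE <-] t0 tt' lq2.
pose v u := val u \mPo lq.
have leaf u : is_leaf (label u) -> (msize (v u) <= 2)%N.
  rewrite /v valE; case: (label u) => //= [i|c] _.
    by rewrite comp_mpolyXU -tnth_nth.
  by rewrite comp_mpolyC msizeC; case: (_ != _).
have vmul u us : label u = Mul us -> v u = \prod_(w <- us) v w.
  by move=> E; rewrite /v valE E /= rmorph_prod.
have vadd u us : label u = Add us -> v u = \sum_(w <- us) v w.
  by move=> E; rewrite /v valE E /= raddf_sum.
have l3 u : layer u = 3%N -> (msize (v u) <= t'.+1)%N.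
  move=> u3; have := lab u; case E: (label u) => [i|c|us|us].
  - by move=> _; apply: leq_trans (leaf _ _) _; rewrite ?E.
  - by move=> _; apply: leq_trans (leaf _ _) _; rewrite ?E.
  - by rewrite u3 => -[].
  rewrite u3 => -[[]|[_ us_t]] //; rewrite (vmul _ _ E).
  apply: leq_trans (msize_prod_seq (d := 1) _) _; last first.
    by rewrite muln1 ltnS (leq_trans us_t).
  (* There are no gates in layer 4, so the children of a bottom product are leaves. *)
  move=> w wus; have := ch u w; rewrite E /= => /(_ wus)[/leaf //|].
  rewrite u3 => w4; have := lab w; rewrite w4.
  by case Ew: (label w) => [i|c|ws|ws]; do ?[by rewrite leaf ?Ew | case=> // -[]].
have l2 u : layer u = 2%N -> (msize (v u) <= t'.+1)%N.
  move=> u2; have := lab u; case E: (label u) => [i|c|us|us].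
  - by move=> _; apply: leq_trans (leaf _ _) _; rewrite ?E.
  - by move=> _; apply: leq_trans (leaf _ _) _; rewrite ?E.
  - move=> _; rewrite (vadd _ _ E); apply: msize_sum_seq => w wus.
    have := ch u w; rewrite E u2 /= => /(_ wus)[/leaf lw|/l3 //].
    exact: leq_trans lw _.
  by rewrite u2 => -[[]|[]].
(* Padding by 1 gives every upper product gate exactly [D] factors. *)
pose Q u (j : 'I_D) :=
  if layer u == 1%N then nth 1 (map v (children (label u))) j else 1.
exists Q => [u j|].
  rewrite /Q; case: eqP => [u1|_]; last by rewrite msize1.
  have [lt|le] := ltnP j (size (children (label u))); last first.
    by rewrite nth_default ?size_map ?msize1.
  have := mem_nth u lt; rewrite (nth_map u) // => /ch; rewrite u1.
  by case=> [/leaf lw|/l2 //]; apply: leq_trans lw _.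
rewrite -/(v _); have := ch (output C).
case E: (label (output C)) addo => [||us|] // _ /= chu.
rewrite (vadd _ _ E) big_seq_cond; apply: subproduct_span_sum => w.
rewrite andbT => /chu; rewrite lay0.
(* A leaf below the output is its own coefficient, with the empty subproduct. *)
have span_leaf : is_leaf (label w) -> subproduct_span Q 1 (v w).
  move=> /leaf lw; have := subproduct_span_gen Q w set0 lw.
  by rewrite big_set0 mulr1.
case=> [//|w1]; have := lab w; case Ew: (label w) => [i|c|ws|ws].
- by rewrite Ew in span_leaf => _; apply: span_leaf.
- by rewrite Ew in span_leaf => _; apply: span_leaf.
- by rewrite w1 => -[].
rewrite w1 => -[[_ wsD]|[]] //.
have -> : v w = 1 * \prod_(j in [set: 'I_D]) Q w j.
  rewrite mul1r (vmul _ _ Ew) -(big_map v predT id) (big_nth 1) size_map.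
  transitivity (\prod_(0 <= j < D) nth 1 (map v ws) j).
    rewrite [RHS](@big_cat_nat _ _ _ (size ws)) //=.
    rewrite [X in _ * X]big_nat_cond [X in _ * X]big1 ?mulr1 // => j.
    by rewrite andbT => /andP[le _]; rewrite nth_default ?size_map.
  rewrite big_mkord; apply: eq_big => j; rewrite ?inE // => _.
  by rewrite /Q w1 Ew.
by apply: subproduct_span_gen; rewrite msize1.
Qed.

(** * The Nisan-Wigderson polynomial *)

Local Open Scope nat_scope.

(** The multiples of [m] are the [m + v] with [v] of degree at most [L - mdeg m]. If [mdeg m > L]
    there are none, while the truncated difference makes the binomial 1: the bound holds but is
    strict. *)
Lemma card_mnm_multiples N (m : 'X_{1..N}) (L : nat) :
  #|[set u : 'X_{1..N < L.+1} | (m <= u)%MM]| <= 'C(N + (L - mdeg m), N)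
    ?= iff (mdeg m <= L).
Proof.
have [mL|mL] := leqP (mdeg m) L; last first.
  rewrite (_ : [set _ | _] = set0) ?cards0.
    by split; rewrite // eq_sym -leqn0 leqNgt bin_gt0 leq_addr.
  apply/setP=> u; rewrite !inE; apply/negbTE/negP => /submK mu.
  have := bmdeg u; rewrite -mu mdegD ltnS; lia.
have lt (v : 'X_{1..N < (L - mdeg m).+1}) : mdeg (m + v)%MM < L.+1.
  by have := bmdeg v; rewrite mdegD; lia.
pose f v := BMultinom (lt v).
have f_inj : injective f.
  move=> v v' /(congr1 val) /= E; apply/val_inj => /=.
  by rewrite -[LHS](addmK m) -[RHS](addmK m) addmC E addmC.
suff -> : [set u : 'X_{1..N < L.+1} | (m <= u)%MM] = f @: setT.
  by rewrite card_imset // cardsT card_bmultinom; split; rewrite ?eqxx.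
apply/setP => u; rewrite !inE; apply/idP/imsetP => [mu|[v _ ->]]; last first.
  by apply/mnm_lepP => i /=; rewrite mnmDE leq_addr.
have lv : mdeg (u - m)%MM < (L - mdeg m).+1.
  have := bmdeg u; rewrite -{1}(submK mu) mdegD; lia.
by exists (BMultinom lv) => //; apply/val_inj => /=; rewrite addmC submK.
Qed.

Lemma npoly_eq_on (K : finFieldType) k (p q : {poly K}) (S : {set K}) :
  size p <= k -> size q <= k -> k <= #|S| ->
  {in S, forall z, p.[z]%R = q.[z]%R} -> p = q.
Proof.
move=> pk qk kS pq; apply/eqP; rewrite -subr_eq0; apply/negPn/negP => nz.
have := max_poly_roots nz (rs := enum S) _ (enum_uniq _).
have -> : all (root (p - q)) (enum S).
  by apply/allP => z; rewrite mem_enum => /pq E; rewrite rootE !hornerE E subrr.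
rewrite -cardE => /(_ isT); rewrite ltnNge => /negP[].
apply: leq_trans kS; apply: leq_trans (size_polyD _ _) _.
by rewrite size_polyN geq_max pk.
Qed.

Section NisanWigderson.
Context (K : finFieldType) (N : nat) (x : K -> K -> 'I_N).
Context (x_inj : forall z y z' y', x z y = x z' y' -> z = z' /\ y = y').
Implicit Types (Z : {set K}) (a b : K -> K).

Definition graph_mnm Z a : 'X_{1..N} := (\sum_(z in Z) U_(x z (a z)))%MM.

Lemma graph_mnmE Z a i : graph_mnm Z a i = [exists z in Z, x z (a z) == i].
Proof.
rewrite mnm_sumE; case: existsP => [[z /andP[zZ /eqP <-]]|no].
  rewrite (bigD1 z) //= mnm1E eqxx big1 // => z' /andP[_ zz'].
  by rewrite mnm1E; case: eqP => // /x_inj[zE]; rewrite zE eqxx in zz'.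
rewrite big1 // => z zZ; rewrite mnm1E; case: eqP => // E.
by case: no; exists z; rewrite zZ E eqxx.
Qed.

Lemma graph_mnmxE Z a z y : graph_mnm Z a (x z y) = (z \in Z) && (a z == y).
Proof.
rewrite graph_mnmE; congr (nat_of_bool _); apply/existsP/andP.
  by move=> [z' /andP[zZ /eqP/x_inj[<- <-]]].
by move=> [zZ /eqP <-]; exists z; rewrite zZ eqxx.
Qed.

Lemma mdeg_graph_mnm Z a : mdeg (graph_mnm Z a) = #|Z|.
Proof.
by rewrite mdeg_sum -sum1_card; apply: eq_bigr => z _; rewrite mdeg1.
Qed.

Lemma graph_mnmID Z Z' a : Z' \subset Z ->
  graph_mnm Z a = (graph_mnm Z' a + graph_mnm (Z :\: Z') a)%MM.
Proof. by move=> ZZ'; rewrite /graph_mnm (big_setID Z') /= (setIidPr ZZ'). Qed.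

Lemma eq_graph_mnm Z a b : {in Z, a =1 b} -> graph_mnm Z a = graph_mnm Z b.
Proof. by move=> ab; apply: eq_bigr => z /ab ->. Qed.

(** All exponents are 0 or 1, so deriving produces no integer factor other than 0 or 1, in any
    characteristic. *)
Lemma graph_mnm_mderivm (F : fieldType) Z Z' a b : Z' \subset Z ->
  'X_[graph_mnm Z a]^`M[graph_mnm Z' b] =
  (if [forall z in Z', a z == b z] then 'X_[graph_mnm (Z :\: Z') a] else 0)%R
  :> {mpoly F[N]}.
Proof.
move=> ZZ'; rewrite mderivmX; case: ifPn => [/forall_inP ab|].
  have {}ab : {in Z', a =1 b} by move=> z /ab/eqP.
  rewrite big1 => [|i _].
    by rewrite (graph_mnmID a ZZ') (eq_graph_mnm ab) addmC addmK scale1r.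
  rewrite [graph_mnm Z' b i]graph_mnmE; case: exists_inP => [[z zZ' /eqP<-]|] //.
  by rewrite graph_mnmxE (subsetP ZZ') // ab // eqxx.
rewrite negb_forall_in => /exists_inP[z zZ' ab].
rewrite (bigD1 (x z (b z))) //= !graph_mnmxE zZ' eqxx (negPf ab) andbF.
by rewrite mul0n scale0r.
Qed.

(** Variables are bare indices, so the row and the column of [i] are recovered by existentials; an
    index outside the rows of [Z] stays a variable. *)
Definition restriction (F : fieldType) Z : N.-tuple {mpoly F[N]} :=
  [tuple if [exists z in Z, exists y, x z y == i]
         then ([exists z in Z, x z 0%R == i]%:R)%R else 'X_i | i < N].

Lemma msize_restriction (F : fieldType) Z i :
  msize (tnth (restriction F Z) i) <= 2.
Proof.
rewrite tnth_mktuple; case: ifP => _; last by rewrite msizeX mdeg1.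
by move: (nat_of_bool _) => e; rewrite -mpolyC_nat msizeC; case: (_ != _).
Qed.

Lemma restriction_prod (F : fieldType) Z a :
  (\prod_z 'X_(x z (a z)) \mPo restriction F Z =
   if [forall z in Z, a z == 0] then 'X_[graph_mnm (~: Z) a] else 0)%R.
Proof.
rewrite rmorph_prod (eq_bigr (fun z => if z \in Z then (a z == 0%R)%:R
   else 'X_(x z (a z)))%R); last first.
  move=> z _; rewrite /= comp_mpolyXU -tnth_nth tnth_mktuple.
  have -> : [exists z' in Z, exists y, x z' y == x z (a z)] = (z \in Z).
    apply/existsP/idP => [[z' /andP[zZ /existsP[y /eqP/x_inj[<-]]]]|zZ] //.
    by exists z; rewrite zZ; apply/existsP; exists (a z).
  case: ifP => // zZ; congr (_%:R)%R; congr (nat_of_bool _).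
  apply/existsP/eqP => [[z' /andP[_ /eqP/x_inj[_ <-]]]|->] //.
  by exists z; rewrite zZ eqxx.
rewrite (bigID (mem Z)) /=; case: ifPn => [/forall_inP a0|].
  rewrite big1 => [|z zZ]; last by rewrite zZ a0.
  rewrite mul1r /graph_mnm -mprodXE; apply: eq_big => z; first by rewrite inE.
  by move=> /negPf->.
rewrite negb_forall_in => /exists_inP[z zZ nz].
by rewrite (bigD1 z) //= zZ (negPf nz) !mul0r.
Qed.

(** For [#|S| = k - r] these are the polynomials with at most [k] coefficients that vanish on [S],
    parametrised by a cofactor with [r] free coefficients. *)
Definition vanishing_poly (S : {set K}) r (c : {poly_r K}) : {poly K} :=
  (val c * \prod_(z in S) ('X - z%:P))%R.

Lemma horner_vanishing_poly (S : {set K}) r (c : {poly_r K}) z :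
  z \in S -> (vanishing_poly S c).[z]%R = 0%R.
Proof.
move=> zS; rewrite /vanishing_poly hornerM (bigD1 z) //= hornerM hornerXsubC.
by rewrite subrr mul0r mulr0.
Qed.

Lemma size_vanishing_poly (S : {set K}) r (c : {poly_r K}) :
  size (vanishing_poly S c) <= r + #|S|.
Proof.
apply: leq_trans (size_polyMleq _ _) _.
rewrite -big_enum size_prod_XsubC -cardE addnS /= leq_add2r.
exact: size_npoly.
Qed.

(** Off [S] the product of linear factors is nonzero, so agreement passes to the cofactors, and
    these coincide once they agree at [r] points. *)
Lemma vanishing_poly_agree (S Z : {set K}) r (c c' : {poly_r K}) :
  [disjoint S & Z] -> c != c' ->
  #|[set z in Z | (vanishing_poly S c).[z]%R == (vanishing_poly S c').[z]%R]| < r.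
Proof.
move=> SZ; apply: contraNltn => rG; apply/eqP/val_inj.
apply: npoly_eq_on rG _; rewrite ?size_npoly // => z; rewrite inE => /andP[zZ].
rewrite /vanishing_poly !hornerM => /eqP; apply: mulIf.
rewrite horner_prod; apply/prodf_neq0 => y yS; rewrite hornerXsubC subr_eq0.
by apply: contraTneq zZ => ->; rewrite (disjointFr SZ).
Qed.

(** Each [A c] has exactly ['C(N + l, N)] elements. Two distinct graphs differ on more than
    [#|Z| - r >= h] rows, where a common multiple contains both variables; its degree thus leaves at
    most [l - h] for the shift. *)
Lemma shifted_monomials_count (S Z : {set K}) r l h (A :=
    fun c : {poly_r K} => [set u : 'X_{1..N < (#|Z| + l).+1} |
      (graph_mnm Z (horner (vanishing_poly S c)) <= u)%MM]) :
  [disjoint S & Z] -> h + r <= #|Z| ->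
  #|K| ^ r * 'C(N + l, N) <= #|\bigcup_c A c| +
    #|K| ^ r * #|K| ^ r * 'C(N + (l - h), N).
Proof.
move=> SZ hrZ.
have sE : size (index_enum {poly_r K}) = #|K| ^ r.
  by rewrite -card_npoly cardE enumT.
rewrite -sE; apply: card_bigcup_ge => [|c|c c' cc'].
- exact: index_enum_uniq.
- have := card_mnm_multiples (graph_mnm Z (horner (vanishing_poly S c))) (#|Z| + l).
  rewrite mdeg_graph_mnm leq_addr addKn => -[_ /eqP]; exact.
set a := horner (vanishing_poly S c); set a' := horner (vanishing_poly S c').
pose Z' := [set z in Z | a z != a' z].
apply: (@leq_trans #|[set u : 'X_{1..N < (#|Z| + l).+1} |
    (graph_mnm Z a + graph_mnm Z' a' <= u)%MM]|).
  apply: subset_leq_card; apply/subsetP => u; rewrite !inE.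
  move=> /andP[/mnm_lepP au /mnm_lepP a'u].
  apply/mnm_lepP => i; rewrite mnmDE.
  have := au i; have := a'u i; rewrite -/a -/a' !graph_mnmE.
  have [/exists_inP[z zZ' /eqP <-]|_] := boolP [exists z in Z', x z (a' z) == i].
    move: zZ'; rewrite inE => /andP[zZ az].
    have -> : [exists z' in Z, x z' (a' z') == x z (a' z)].
      by apply/exists_inP; exists z.
    case: exists_inP => [[y yZ /eqP/x_inj[yz E]]|//].
    by rewrite -yz E yz eqxx in az.
  by rewrite addn0.
apply: leq_trans (card_mnm_multiples _ _) _; apply: leq_bin2l.
rewrite leq_add2l mdegD !mdeg_graph_mnm.
have := vanishing_poly_agree SZ cc'.
have := cardsID [set z | a z == a' z] Z.
have -> : Z :&: [set z | a z == a' z] = [set z in Z | a z == a' z].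
  by apply/setP => z; rewrite !inE.
have -> : Z :\: [set z | a z == a' z] = Z'.
  by apply/setP => z; rewrite !inE andbC.
rewrite -/a -/a'; lia.
Qed.

(* Deriving along the monomial of [c] over [S'] isolates a single monomial,
   since a polynomial with at most [k] coefficients is determined by its values
   on the [k] points of [S :|: S']. *)
Lemma restriction_mderivm (F : fieldType) n k r (S S' : {set K})
    (c : {poly_r K}) : k <= n -> [disjoint S & S'] -> #|S| + r = k -> #|S'| = r ->
  ((\sum_(a : {poly_n K} | (size a <= k)%N) \prod_z 'X_(x z (val a).[z]))
    \mPo restriction F S)^`M[graph_mnm S' (horner (vanishing_poly S c))]%R =
  'X_[graph_mnm (~: (S :|: S')) (horner (vanishing_poly S c))] :> {mpoly F[N]}.
Proof.
move=> kn SS' Srk S'r; set b := vanishing_poly S c.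
have bk : size b <= k by rewrite -Srk addnC size_vanishing_poly.
have bn : size b <= n by apply: leq_trans kn.
have S'S : S' \subset ~: S by rewrite -disjoints_subset disjoint_sym.
have vb : npolyp n b = b :> {poly K} by rewrite npolypK.
rewrite [X in mderivm _ X]raddf_sum [LHS]raddf_sum.
rewrite (bigD1 (npolyp n b)) /=; last by rewrite vb.
rewrite vb restriction_prod.
have -> : [forall z in S, b.[z]%R == 0%R].
  by apply/forall_inP => z zS; rewrite horner_vanishing_poly.
rewrite graph_mnm_mderivm //.
have -> : [forall z in S', b.[z]%R == b.[z]%R] by apply/forall_inP.
rewrite setCU setDE [X in (_ + X)%R]big1 ?addr0 // => a /andP[ak ab].
rewrite restriction_prod; case: ifPn => [/forall_inP a0|]; last by rewrite raddf0.
rewrite graph_mnm_mderivm //; case: ifPn => // /forall_inP aS'.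
case/negP: ab; apply/eqP/val_inj; rewrite /= vb.
apply: (npoly_eq_on (k := k) (S := S :|: S')) => //.
  by rewrite cardsU (disjoint_setI0 SS') cards0 subn0 S'r Srk.
move=> z; rewrite inE => /orP[zS|/aS'/eqP //].
by rewrite (eqP (a0 z zS)) horner_vanishing_poly.
Qed.

Lemma ex_subset_card (T : finType) (A : {set T}) m : m <= #|A| ->
  exists2 B : {set T}, B \subset A & #|B| = m.
Proof.
move=> /card_geqP[s [us sm sA]]; exists [set z in s].
  by apply/subsetP => z; rewrite inE; apply: sA.
by rewrite cardsE; move/card_uniqP: us => ->.
Qed.

(** The rows split into [S] for the restriction, [S'] for the derivatives and the other [n - k] rows
    [Z], which carry the isolated monomials. The last numerical hypothesis is 2e <= h with e = r t'
    + 1 and h = n - k - r. *)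
Lemma nw_circuit_size (F : fieldType) n k r D t t' (C : circuit F N) :
  0 < n -> #|K| = n -> n * n <= N -> 0 < t' -> t <= t' -> r <= k ->
  k + r + 2 * (r * t').+1 <= n ->
  SigmaPiSigmaPi D t C ->
  computes C (\sum_(a : {poly_n K} | (size a <= k)%N)
    \prod_z 'X_(x z (val a).[z]))%R ->
  n ^ r <= 8 * (circuit_size C * 2 ^ D) ^ 2.
Proof.
move=> n0 Kn nN t'0 tt' rk hn CD CP.
have [S _ Sk] : exists2 S : {set K}, S \subset setT & #|S| = k - r.
  by apply: ex_subset_card; rewrite cardsT Kn; lia.
have [S' SS' S'r] : exists2 S' : {set K}, S' \subset ~: S & #|S'| = r.
  by apply: ex_subset_card; have := cardsC S; rewrite Kn Sk; lia.
pose Z := ~: (S :|: S'); pose h := n - k - r.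
have disSS' : [disjoint S & S'] by rewrite disjoint_sym disjoints_subset.
have ZE : #|Z| = n - k.
  have := cardsC (S :|: S'); rewrite Kn cardsU (disjoint_setI0 disSS') cards0.
  rewrite -/Z; lia.
have SZ : [disjoint S & Z].
  by rewrite disjoints_subset setCK subsetUl.
have [||l [hl low up]] := ex_shift_degree (r := r) (h := h) n0 _ _ nN.
- by rewrite /h; nia.
- by rewrite /h; lia.
have [Q Qt CQ] := circuit_subproduct_span CD CP t'0 tt' (msize_restriction F S).
(* Coefficient degrees start at 1 and grow by [t'] with each of the [r] derivatives. *)
apply: (shifted_count_arith (e := (r * t').+1) n0 _ hl low up).
  by rewrite /h; lia.
pose A := fun c : {poly_r K} => [set u : 'X_{1..N < (#|Z| + l).+1} |
      (graph_mnm Z (horner (vanishing_poly S c)) <= u)%MM].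
have := @shifted_monomials_count S Z r l h SZ.
rewrite Kn => /(_ _)/leq_trans; apply; first by rewrite ZE /h; lia.
rewrite leq_add2r -/A.
pose s : seq 'X_{1..N} := [seq val u | u <- enum (\bigcup_c A c)].
have -> : #|\bigcup_c A c| = size s by rewrite size_map cardE.
have -> : circuit_size C * 2 ^ D = #|node C| * 2 ^ #|'I_D| by rewrite card_ord.
apply: (subproduct_span_card (Q := Q)).
  by rewrite map_inj_uniq ?enum_uniq //; exact: val_inj.
move=> m /mapP[u]; rewrite mem_enum => /bigcupP[c _]; rewrite inE => cu ->.
(* An element of [A c] is the isolated monomial of [c] shifted by degree at most [l], so it lies in
   the span obtained from the circuit. *)
have E := @restriction_mderivm F n k r S S' c _ disSS' _ S'r.
rewrite -[val u](submK cu) mpolyXD -{}E; [|by lia|by rewrite Sk subnK].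
set b := horner (vanishing_poly S c).
have lu : mdeg (u - graph_mnm Z b)%MM <= l.
  have := bmdeg u; rewrite -{1}(submK cu) mdegD mdeg_graph_mnm -/b; lia.
have := subproduct_spanX (u - graph_mnm Z b)%MM
  (subproduct_span_mderivs (fun z => x z (b z)) S' Qt CQ).
by apply: subproduct_span_leq; rewrite S'r; lia.
Qed.

End NisanWigderson.

(** * Asymptotics *)

Local Open Scope ring_scope.

Lemma mxvec_index_inj m n (i i' : 'I_m) (j j' : 'I_n) :
  mxvec_index i j = mxvec_index i' j' -> i = i' /\ j = j'.
Proof. by move=> /cast_ord_inj/enum_rank_inj[]. Qed.

(** [k] is the ceiling of eps n. The zero polynomial, of size 0, passes both tests because eps n >
    0. *)
Lemma size_npoly_lt (R : realType) (eps : R) n : 0 < eps -> eps < 1 -> (0 < n)%N ->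
  exists k : nat, [/\ forall s : nat, ((s.-1)%:R < eps * n%:R) = (s <= k)%N,
     eps * n%:R <= k%:R & k%:R <= eps * n%:R + 1].
Proof.
move=> e0 e1 n0.
have ex : exists k : nat, eps * n%:R <= k%:R.
  by exists n; rewrite ler_piMl // ltW.
case: (ex_minnP ex) => k kn kmin.
have en : 0 < eps * n%:R by rewrite mulr_gt0 // ltr0n.
have k0 : (0 < k)%N by rewrite -(ltr0n R); apply: lt_le_trans kn.
exists k; split=> // [s|]; last first.
  rewrite -(prednK k0) -natr1 lerD2r ltW // ltNge; apply/negP => /kmin.
  by rewrite leqNgt ltn_predL k0.
have -> : (s <= k)%N = (s.-1 < k)%N by case: s.
apply/idP/idP => [lt|lt]; last first.
  by rewrite ltNge; apply/negP => /kmin; rewrite leqNgt lt.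
by rewrite -(ltr_nat R); apply: lt_le_trans kn.
Qed.

(** Taking logarithms, r ln n <= 3 ln 2 + 2 (ln s + D ln 2). The left side is at least (d q / 2) ln
    n, and half of that absorbs the terms in ln 2, which are at most (3 + 2 |A|) q. *)
Lemma ln_lower_bound (R : realType) (d A : R) (n r s D : nat)
    (q := Num.sqrt (n%:R : R)) : 0 < d -> (0 < n)%N ->
  1 <= q -> 2 <= d * q -> (3 + 2 * `|A|) * 4 <= d * ln n%:R ->
  d * q - 1 <= r%:R -> D%:R <= A * q ->
  (n ^ r <= 8 * (s * 2 ^ D) ^ 2)%N ->
  2%:R `^ (d / 8 * q * ln n%:R) <= s%:R :> R.
Proof.
move=> d0 n0 q1 dq lnn rq DA le.
have s0 : (0 < s)%N.
  case: s le => //; rewrite mul0n exp0n // muln0 leqn0 expn_eq0.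
  by move=> /andP[/eqP n00]; rewrite n00 in n0.
have ln2 : ln 2 <= 1 :> R.
  rewrite -[leRHS]expRK ler_ln ?posrE ?expR_gt0 //.
  by have := expR_ge1Dx (1 : R).
have ln2_0 : 0 <= ln 2 :> R by rewrite ln_ge0 // ler1n.
have lnn0 : 0 <= ln n%:R :> R by rewrite ln_ge0 // ler1n.
have logle : ln n%:R *+ r <= ln 2 *+ 3 + (ln s%:R + ln 2 *+ D) *+ 2 :> R.
  have n0' : 0 < n%:R :> R by rewrite ltr0n.
  have s0' : 0 < s%:R :> R by rewrite ltr0n.
  rewrite -!lnXn ?exprn_gt0 // -lnM ?posrE ?exprn_gt0 //.
  rewrite -lnXn ?mulr_gt0 ?exprn_gt0 // -lnM ?posrE ?exprn_gt0 ?mulr_gt0 ?exprn_gt0 //.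
  rewrite ler_ln ?posrE ?mulr_gt0 ?exprn_gt0 ?mulr_gt0 ?exprn_gt0 //.
  by rewrite -natrX -natrX -natrX -natrM -natrX -natrM ler_nat.
rewrite /powR pnatr_eq0 /= -[leRHS]lnK ?posrE ?ltr0n // ler_expR.
have DA' : ln 2 *+ D <= `|A| * q.
  rewrite -[ln 2 *+ D]mulr_natr; apply: (@le_trans _ _ D%:R).
    by rewrite ler_piMl.
  by apply: le_trans DA _; rewrite ler_wpM2r ?ler_norm // sqrtr_ge0.
have big : (d * q - 1) * ln n%:R <= ln n%:R *+ r.
  by rewrite -[leRHS]mulr_natl ler_wpM2r.
have half : d * q / 2 * ln n%:R <= (d * q - 1) * ln n%:R.
  by rewrite ler_wpM2r //; lra.
have quarter : (3 + 2 * `|A|) * q <= d * q / 4 * ln n%:R.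
  have := ler_wpM2r (le_trans ler01 q1) lnn; lra.
have q3 : 3 <= 3 * q by lra.
(* Since ln 2 <= 1, the bound on ln s passes to base 2. *)
have ln2q : d / 8 * q * ln n%:R * ln 2 <= d / 8 * q * ln n%:R.
  by rewrite ler_piMr // !mulr_ge0 // ?invr_ge0 //; lra.
apply: le_trans ln2q _; move: logle; rewrite mulrnDl; lra.
Qed.

(** [c] is chosen before [A], so it depends on [eps] alone; the constant [A] of O(sqrt n) only moves
    the threshold [n0]. *)
Theorem theorem4 (R : realType) (eps : R) (eps_gt0 : 0 < eps) (eps_lt1 : eps < 1) :
  exists2 c : R, 0 < c &
  forall A : R,
  exists n0 : nat,
  forall (n : nat) (K : finFieldType) (idx : K -> 'I_n) (F : fieldType)
    (D t : nat) (C : circuit F (n * n)),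
  (n0 <= n)%N ->
  #|K| = n ->
  bijective idx ->
  D%:R <= A * Num.sqrt (n%:R : R) ->
  t%:R <= Num.sqrt (n%:R : R) ->
  SigmaPiSigmaPi D t C ->
  computes C (NW eps F idx) ->
  2%:R `^ (c * Num.sqrt (n%:R : R) * ln n%:R) <= (circuit_size C)%:R :> R.
Proof.
(* With r about d sqrt n, d <= eps ensures r <= k, and d <= (1 - eps)/8 leaves room for k + r + 2 (r
   t' + 1) <= n. *)
pose d := eps * (1 - eps) / 8.
have e1 : 0 < 1 - eps by rewrite subr_gt0.
have d0 : 0 < d by rewrite divr_gt0 // mulr_gt0.
have d1 : d <= (1 - eps) / 8 by rewrite ler_pM2r ?invr_gt0 // ler_piMl // ltW.
have d2 : d <= eps by rewrite /d; nra.
exists (d / 8); first by rewrite divr_gt0.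
(* The three summands ensure n (1 - eps) >= 8, d sqrt n >= 2 and d ln n >= 4 (3 + 2 |A|). *)
move=> A; pose X := 8 / (1 - eps) + (2 / d) ^+ 2 + expR ((3 + 2 * `|A|) * 4 / d).
exists (Num.truncn X).+1 => n K idx F D t C nX Kn idx_bij DA tq CD CP.
have {nX} Xn : X <= n%:R.
  by apply: le_trans (ltW (truncnS_gt X)) _; rewrite ler_nat.
have X1 : 0 <= 8 / (1 - eps) by rewrite divr_ge0 // ltW.
have X2 : 0 <= (2 / d) ^+ 2 by rewrite sqr_ge0.
have X3 : 0 < expR ((3 + 2 * `|A|) * 4 / d) by rewrite expR_gt0.
set q := Num.sqrt _ in DA tq *.
have n8 : 8 / (1 - eps) <= n%:R by move: Xn; rewrite /X; lra.
have n1 : 1 <= n%:R :> R.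
  apply: le_trans n8; rewrite ler_pdivlMr //; lra.
have n0 : (0 < n)%N by rewrite -(ler1n R).
have qq : q * q = n%:R by rewrite -expr2 sqr_sqrtr.
have q0 : 0 <= q := sqrtr_ge0 _.
have q1 : 1 <= q by rewrite -sqrtr1 ler_sqrt.
have dq : 2 <= d * q.
  rewrite mulrC -ler_pdivrMr //.
  have -> : 2 / d = Num.sqrt ((2 / d) ^+ 2).
    by rewrite sqrtr_sqr ger0_norm // divr_ge0 // ltW.
  by rewrite ler_wsqrtr //; move: Xn; rewrite /X; lra.
have lnn : (3 + 2 * `|A|) * 4 <= d * ln n%:R.
  rewrite [d * _]mulrC -ler_pdivrMr // -[leLHS]expRK ler_ln ?posrE ?expR_gt0 ?ltr0n //.
  by move: Xn; rewrite /X; lra.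
pose r := Num.truncn (d * q).
have dq0 : 0 <= d * q by rewrite mulr_ge0 // ltW.
have [rle rge] : r%:R <= d * q /\ d * q - 1 <= r%:R.
  have /andP[-> /ltW] := truncn_itv dq0; rewrite -natr1 => ?; split=> //.
  by rewrite lerBlDr.
apply: (@ln_lower_bound _ d A n r (circuit_size C) D) => //.
have [k [kE kge kle]] := size_npoly_lt eps_gt0 eps_lt1 n0.
have qn : q <= n%:R by rewrite -qq ler_peMl.
(* Raising [t] to at least 1 keeps it below sqrt n, so r t' <= d n. *)
have t'q : (maxn 1 t)%:R <= q by rewrite /maxn; case: ifP.
have rt : (r * maxn 1 t)%:R <= d * n%:R.
  by rewrite natrM -qq mulrA ler_pM.
pose x z y := mxvec_index (idx z) (idx y).
apply: (@nw_circuit_size K _ x _ F n k r D t (maxn 1 t) C) => //.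
- move=> z y z' y' /mxvec_index_inj[/(bij_inj idx_bij) -> ].
  by move=> /(bij_inj idx_bij) ->.
- exact: leq_maxl.
- exact: leq_maxr.
- rewrite -(ler_nat R); apply: le_trans kge; apply: le_trans rle _.
  by apply: ler_pM => //; rewrite ltW.
- rewrite -(ler_nat R) !natrD natrM -natr1.
  have : 8 <= n%:R * (1 - eps) by rewrite -ler_pdivrMr.
  have : d * q <= d * n%:R by rewrite ler_pM2l.
  have : d * n%:R <= (1 - eps) / 8 * n%:R by rewrite ler_pM2r ?ltr0n.
  lra.
have -> // : \sum_(a : {poly_n K} | (size a <= k)%N)
    \prod_z 'X_(x z (val a).[z]) = NW eps F idx.
by apply: eq_bigl => a; rewrite kE.
Qed.
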